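(* Let $R$ be a finite commutative ring with unity, $I$ an ideal of $R$, and $G=\Gamma_I(R)$ with vertex set $V$. Let $C_1,\dots,C_k$ be the twin classes of $G$, $n_i=|C_i|$, $c_i\in C_i$ representatives and $H=G[\{c_1,\dots,c_k\}]$. Then for every integer $m\ge 2$, $$SW_m(G)=\sum_{\substack{1\le i\le k\\ G[C_i]\text{ complete}}}(m-1)\binom{n_i}{m}+\sum_{\substack{1\le i\le k\\ G[C_i]\text{ edgeless}}} m\binom{n_i}{m}+\sum_{\substack{S\subseteq V,\ |S|=m\\ |I(S)|=l>1}}\Big(d_H^l(S_r)+\sum_{i\in I(S)}(t_i-1)\Big),$$ where $I(S)=\{i:S\cap C_i\ne\emptyset\}$, $l=|I(S)|$, $S_r=\{c_i:i\in I(S)\}$, $t_i=|S\cap C_i|$.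
   Context: The ideal-based zero-divisor graph $\Gamma_I(R)$ has vertex set $\{x\in R\setminus I: xy\in I \text{ for some } y\in R\setminus I\}$, distinct $x,y$ adjacent iff $xy\in I$ (it is connected). Twin classes of a graph are the classes of the equivalence relation $u\sim v$ iff $N(u)\setminus\{v\}=N(v)\setminus\{u\}$ ($N$ = open neighbourhood); each induced subgraph on a twin class is complete or edgeless. For a connected graph $X$ and an $l$-set $S$ of vertices, $d_X^l(S)$ is the number of edges of a smallest subtree of $X$ containing $S$; $SW_m(X)=\sum_{|S|=m}d_X^m(S)$. *)

(* Defs.v *)
From HB Require Import structures.
From mathcomp Require Import all_boot all_order all_algebra.

Set Implicit Arguments.
Unset Strict Implicit.
Unset Printing Implicit Defensive.

Local Open Scope nat_scope.

(* A finite simple graph on a ground type T is a pair (V, E) with V a set of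
   elements of T and E a set of two-element subsets of V. The vertex set need
   not be all of T, so subgraphs of a graph are graphs on the same T. *)
Definition graph_axiom (T : finType) (p : {set T} * {set {set T}}) : bool :=
  [forall e in p.2, (#|e| == 2) && (e \subset p.1)].

Definition graph (T : finType) : finType := {p | @graph_axiom T p}.

Section Graph.
Variable T : finType.
Implicit Types X Y : graph T.

Definition vset X : {set T} := (val X).1.

Definition eset X : {set {set T}} := (val X).2.

Definition adj X : rel T := [rel x y | [set x; y] \in eset X].

Definition nbh X x : {set T} := [set y | adj X x y].

Lemma induced_subproof X (W : {set T}) :
  graph_axiom (vset X :&: W, [set e in eset X | e \subset W]).
Proof.
apply/forall_inP => e; rewrite inE => /andP[eX eW] /=.
have /forall_inP/(_ e eX)/andP[-> eV] := valP X.
by rewrite subsetI eV.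
Qed.

Definition induced X (W : {set T}) : graph T := Sub _ (induced_subproof X W).

Definition complete X : bool :=
  [forall x in vset X, forall y in vset X, (x != y) ==> adj X x y].

Definition edgeless X : bool := eset X == set0.

Definition connected X : bool :=
  [forall x in vset X, forall y in vset X, connect (adj X) x y].

(* A cycle has at least three vertices, all distinct, hence at most #|T|. *)
Definition acyclic X : bool :=
  [forall n : 'I_#|T|.+1, forall c : n.-tuple T, ucycleb (adj X) c ==> (n < 3)].

Definition tree X : bool := [&& vset X != set0, connected X & acyclic X].

Definition subgraph Y X : bool :=
  (vset Y \subset vset X) && (eset Y \subset eset X).

Definition twin X : rel T := [rel x y | nbh X x :\ y == nbh X y :\ x].

Definition twin_classes X : {set {set T}} :=
  equivalence_partition (twin X) (vset X).

(* Y is a subtree of X that contains S. *)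
Definition subtree_on X (S : {set T}) Y : bool :=
  [&& subgraph Y X, tree Y & S \subset vset Y].

(* The default value of the minimum is the number of edges of X, which bounds
   that of every subtree: it matters only if no subtree of X contains S. *)
Definition steiner_dist X (S : {set T}) : nat :=
  \big[minn/#|eset X|]_(Y : graph T | subtree_on X S Y) #|eset Y|.

Definition steiner_wiener (m : nat) X : nat :=
  \sum_(S : {set T} | (S \subset vset X) && (#|S| == m)) steiner_dist X S.

Lemma steiner_distP X S Y0 : subtree_on X S Y0 ->
  (exists2 Y, subtree_on X S Y & steiner_dist X S = #|eset Y|) /\
  (forall Y, subtree_on X S Y -> steiner_dist X S <= #|eset Y|).
Proof.
move=> Y0P.
have minE : steiner_dist X S =
    \big[Order.min/#|eset X|]_(Y : graph T | subtree_on X S Y) #|eset Y|.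
  by [].
have leS Y : subtree_on X S Y -> steiner_dist X S <= #|eset Y|.
  by move=> YP; rewrite minE -leEnat; apply: Order.TotalTheory.bigmin_le_cond.
split=> //.
have [//|dX] : (exists2 Y, subtree_on X S Y & steiner_dist X S = #|eset Y|) \/
    steiner_dist X S = #|eset X|.
  rewrite /steiner_dist; elim/big_rec: _ => [|Y d YP IH]; first by right.
  by rewrite /minn; case: ltnP => // _; left; exists Y.
exists Y0 => //; apply/eqP; rewrite eqn_leq leS //= dX.
by apply: subset_leq_card; case/and3P: Y0P => /andP[].
Qed.

End Graph.

Section ZeroDivisorGraph.
Import GRing.Theory.
Local Open Scope ring_scope.
Variable R : finComPzRingType.

(* Unlike the library's idealr_closed, this does not require I to be proper. *)
Definition is_ideal (I : {set R}) : Prop :=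
  zmod_closed I /\ forall a x : R, x \in I -> a * x \in I.

Variable I : {set R}.

Definition zdg_vset : {set R} :=
  [set x | (x \notin I) && [exists y, (y \notin I) && (x * y \in I)]].

Definition zdg_eset : {set {set R}} :=
  [set [set x; y] | x in zdg_vset, y in zdg_vset & (x != y) && (x * y \in I)].

Lemma zdg_subproof : graph_axiom (zdg_vset, zdg_eset).
Proof.
apply/forall_inP => e /imset2P[x y xV]; rewrite inE => /and3P[yV xy _] -> /=.
by rewrite cards2 xy subUset !sub1set xV yV.
Qed.

(* The ideal-based zero-divisor graph Gamma_I(R). *)
Definition zdg : graph R := Sub _ zdg_subproof.

End ZeroDivisorGraph.

(* Main.v *)
(* Growing a tree leaf by leaf shows that [steiner_dist X S] is one less than
   the size of a smallest connected set of vertices containing [S]. In this form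
   the distance is insensitive to the choice of twins: projecting a connected
   set to class representatives, or lifting a connected set of at least two
   representatives, preserves connectedness, since adjacency between distinct
   classes depends only on the classes. This settles the sets meeting several
   classes. A set inside one class is connected if the class is complete; if the
   class is edgeless, one common neighbour is needed to connect it. *)
Require Import Defs.
From mathcomp Require Import all_boot all_order all_algebra.

Local Open Scope nat_scope.

(** * Adjacency, induced subgraphs and edges leaving a set *)

Section Graphs.
Set Implicit Arguments.
Unset Strict Implicit.
Variable T : finType.
Implicit Types (X Y : graph T) (S W : {set T}) (x y : T).

Lemma edgeP X x y : [set x; y] \in eset X ->
  [/\ x != y, x \in vset X & y \in vset X].
Proof.
move=> xyX; have /forall_inP/(_ _ xyX)/andP[] := valP X.
rewrite cards2 subUset !sub1set; by case: (eqVneq x y) => // xy _ /andP[].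
Qed.

Lemma adj_sym X : symmetric (adj X).
Proof. by move=> x y; rewrite /adj /= setUC. Qed.

Lemma adj_irr X x : adj X x x = false.
Proof. by apply/negP=> /edgeP[]; rewrite eqxx. Qed.

Lemma connect_adj_sym X : connect_sym (adj X).
Proof. exact/sym_connect_sym/adj_sym. Qed.

Lemma graph_eq X Y : vset X = vset Y -> eset X = eset Y -> X = Y.
Proof.
by move: X Y => [[V E] p] [[V' E'] p'] /= eV eE; apply: val_inj; congr (_, _).
Qed.

Lemma vset_induced X W : vset (induced X W) = vset X :&: W.
Proof. by []. Qed.

Lemma adj_induced X W x y :
  adj (induced X W) x y = [&& adj X x y, x \in W & y \in W].
Proof. by rewrite /adj /= {1}/eset /= inE subUset !sub1set. Qed.

Lemma induced_induced X W W' :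
  W' \subset W -> induced (induced X W) W' = induced X W'.
Proof.
move=> sW; apply: graph_eq; first by rewrite !vset_induced -setIA (setIidPr sW).
apply/setP=> e; rewrite !inE -andbA; case: (e \in eset X) => //=.
by case: (boolP (e \subset W')) => [/subset_trans-> //|]; rewrite andbF.
Qed.

Lemma subgraph_trans X Y Z : subgraph X Y -> subgraph Y Z -> subgraph X Z.
Proof.
move=> /andP[v e] /andP[v' e'].
by rewrite /subgraph (subset_trans v v') (subset_trans e e').
Qed.

Lemma subgraph_induced X W : subgraph (induced X W) X.
Proof.
by apply/andP; split; [apply: subsetIl | apply/subsetP=> e; rewrite inE => /andP[]].
Qed.

(** If no edge left [W], then [W] would be closed under adjacency, and a path from [x] could never
    reach [y]. *)
Lemma connected_crossing X W x y : connected X ->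
  x \in vset X -> y \in vset X -> x \in W -> y \notin W ->
  exists u v, [/\ u \in W, v \notin W & adj X u v].
Proof.
move=> /forall_inP cX xX yX xW yW.
case: (boolP [exists u in W, exists v, (v \notin W) && adj X u v]).
  by case/exists_inP=> u uW /existsP[v /andP[vW uv]]; exists u, v.
move=> /exists_inPn noX; case/negP: yW.
have cW : closed (adj X) (mem W).
  apply: intro_closed; first exact: connect_adj_sym.
  move=> u v uv uW; have /existsPn/(_ v) := noX u uW.
  by rewrite uv andbT negbK.
by have /forall_inP/(_ y yX)/(closed_connect cW) <- := cX x xX.
Qed.

(** * Trees grown leaf by leaf *)

Lemma singleton_subproof x : graph_axiom ([set x], set0 : {set {set T}}).
Proof. by apply/forall_inP => e; rewrite inE. Qed.

Definition singleton x : graph T := Sub _ (singleton_subproof x).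

Lemma add_leaf_subproof Y u v (uvP : (u \in vset Y) && (v \notin vset Y)) :
  graph_axiom (v |: vset Y, [set u; v] |: eset Y).
Proof.
case/andP: uvP => uY vY; apply/forall_inP => e /setU1P[->|eY] /=.
  rewrite cards2 subUset !sub1set !inE uY eqxx orbT /= andbT.
  by case: (eqVneq u v) uY vY => // -> ->.
have /forall_inP/(_ e eY)/andP[-> eV] := valP Y.
exact: subset_trans eV (subsetUr _ _).
Qed.

Definition add_leaf Y u v (uvP : (u \in vset Y) && (v \notin vset Y)) : graph T := Sub _ (add_leaf_subproof uvP).

(** The vertices of a cycle are distinct, so the bound on the length in [acyclic] misses no
    cycle. *)
Lemma acyclicP Y : reflect
  (forall c : seq T, ucycle (adj Y) c -> size c < 3) (acyclic Y).
Proof.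
apply: (iffP forallP) => [acY c cc|acY n].
  have /andP[_ uc] := cc.
  have sc : size c < #|T|.+1 by rewrite ltnS -(card_uniqP uc) max_card.
  by have /forallP/(_ (in_tuple c))/implyP/(_ cc) := acY (Ordinal sc).
by apply/forallP=> c; apply/implyP=> /acY; rewrite size_tuple.
Qed.

Lemma tree_singleton x : tree (singleton x).
Proof.
have noE a b : adj (singleton x) a b = false by rewrite /adj /= inE.
apply/and3P; split; first by apply/set0Pn; exists x; apply: set11.
  by apply/forall_inP=> a /set1P->; apply/forall_inP=> b /set1P->; apply: connect0.
by apply/acyclicP=> -[|a [|b [|d c]]] //; rewrite /ucycle /= noE.
Qed.

(** The only neighbour of [v] is [u]. A cycle of length at least 3 through [v], rotated to start
    there, would have [u] both as second and as last vertex; a cycle avoiding [v] is already a cycle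
    of [Y]. *)
Lemma tree_add_leaf Y u v (uvP : (u \in vset Y) && (v \notin vset Y)) :
  tree Y -> tree (add_leaf uvP).
Proof.
case/and3P=> _ cY /acyclicP acY.
set Y' := add_leaf uvP; have /andP[uY vY] := uvP.
have vu : v != u by apply: contraNneq vY => ->.
have adjE a b : adj Y' a b = ([set a; b] == [set u; v]) || adj Y a b.
  by rewrite /adj /= {1}/eset /= inE in_set1.
have uvY' : adj Y' u v by rewrite adjE eqxx.
have nvY a : adj Y a v = false by apply/negP=> /edgeP[_ _]; apply/negP.
have leaf a : adj Y' a v -> a = u.
  rewrite adjE nvY orbF => /eqP/setP/(_ u).
  by rewrite !inE eqxx /= eq_sym [u == v]eq_sym (negPf vu) orbF => /eqP.
apply/and3P; split; first by apply/set0Pn; exists v; apply: setU11.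
  have toU a : a \in vset Y' -> connect (adj Y') a u.
    case/setU1P=> [->|aY]; first by rewrite connect1 // adj_sym.
    have /forall_inP/(_ a aY)/forall_inP/(_ u uY) := cY.
    by apply: connect_sub => b d bd; rewrite connect1 // adjE bd orbT.
  apply/forall_inP=> a aY; apply/forall_inP=> b bY.
  by rewrite (connect_trans (toU a aY)) // connect_adj_sym toU.
apply/acyclicP=> c cc.
case: (boolP (v \in c)) => vc.
  have [i p Ep] := rot_to vc.
  have : ucycle (adj Y') (v :: p).
    by case/andP: cc; rewrite /ucycle -Ep rot_cycle rot_uniq => -> ->.
  rewrite -(size_rot i) Ep; case/lastP: p {Ep} => // -[|b p] a; first by [].
  case/andP; rewrite /= !rcons_path last_rcons => /andP[vb /andP[_ av]].
  rewrite adj_sym in vb.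
  by rewrite (leaf _ vb) (leaf _ av) mem_rcons mem_head /= andbF.
apply: acY; case/andP: cc => cc uc; rewrite /ucycle uc andbT.
apply: sub_in_cycle cc; last exact: allss.
move=> a b ac bc; rewrite adjE => /orP[/eqP/setP/(_ v)|//].
rewrite !inE eqxx orbT => /orP[] /eqP E.
  by rewrite E ac in vc.
by rewrite E bc in vc.
Qed.

(** As long as the subtree misses a vertex, an edge of [X] leaves it and supplies a new leaf. Both
    cardinals are tracked during the growth, so the edge count comes with the construction. *)
Lemma spanning_tree X : connected X -> vset X != set0 ->
  exists Y, [/\ subgraph Y X, tree Y, vset Y = vset X & #|vset Y| = #|eset Y|.+1].
Proof.
move=> cX /set0Pn[x xX].
have grow n : n < #|vset X| -> exists Y,
    [/\ subgraph Y X, tree Y, #|vset Y| = n.+1 & #|eset Y| = n].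
  elim: n => [_|n IHn ltn].
    exists (singleton x); split; [|exact: tree_singleton|exact: cards1|exact: cards0].
    by apply/andP; split; [rewrite sub1set | apply: sub0set].
  have [Y [/andP[sV sE] tY cV cE]] := IHn (ltnW ltn).
  have /set0Pn[a aY] : vset Y != set0 by rewrite -card_gt0 cV.
  have /subsetPn[b bX bY] : ~~ (vset X \subset vset Y).
    by apply/negP=> /subset_leq_card; rewrite cV leqNgt ltn.
  have [u [v [uY vY uv]]] :=
    connected_crossing cX (subsetP sV a aY) bX aY bY.
  have uvP : (u \in vset Y) && (v \notin vset Y) by rewrite uY.
  have [_ uX vX] := edgeP uv.
  exists (add_leaf uvP); split; last 2 first.
  - by rewrite cardsU1 vY cV.
  - rewrite cardsU1 cE; case: (boolP (_ \in _)) => // /edgeP[_ _].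
    by rewrite (negPf vY).
  - by apply/andP; split; apply/subsetP=> e /setU1P[->//|];
      [apply: (subsetP sV) | apply: (subsetP sE)].
  - exact: tree_add_leaf.
have Xgt0 : 0 < #|vset X| by rewrite card_gt0; apply/set0Pn; exists x.
have [|Y [sY tY cV cE]] := grow #|vset X|.-1; first by rewrite prednK.
exists Y; split=> //; last by rewrite cV cE.
by apply/eqP; rewrite eqEcard cV prednK // leqnn andbT; case/andP: sY.
Qed.

(** * Steiner distance through connected vertex sets *)

Definition connected_set X W : bool :=
  [&& W != set0, W \subset vset X & connected (induced X W)].

Lemma connected_setP X W : reflect
  [/\ W != set0, W \subset vset X &
      {in W &, forall x y, connect (adj (induced X W)) x y}]
  (connected_set X W).
Proof.
apply: (iffP and3P) => -[W0 sW cW]; split=> //.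
  move=> x y xW yW; have /forall_inP := cW; rewrite vset_induced (setIidPr sW).
  by move=> /(_ x xW)/forall_inP/(_ y yW).
apply/forall_inP=> x; rewrite vset_induced (setIidPr sW) => xW.
by apply/forall_inP=> y yW; apply: cW.
Qed.

(** This lets Steiner distances in the graph on the representatives be computed with connected sets
    of the whole graph. *)
Lemma connected_set_induced X W' W :
  connected_set (induced X W') W = (W \subset W') && connected_set X W.
Proof.
rewrite /connected_set vset_induced subsetI.
case: (boolP (W \subset W')) => WW'; last by rewrite !andbF.
by rewrite induced_induced // andbT.
Qed.

Lemma connected_set_vset X : connected X -> vset X != set0 -> connected_set X (vset X).
Proof.
move=> cX X0; rewrite /connected_set X0 subxx /=.
suff -> : induced X (vset X) = X by [].
apply: graph_eq; first by rewrite vset_induced setIid.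
apply/setP=> e; rewrite inE; case: (boolP (e \in eset X)) => //= eX.
by have /forall_inP/(_ e eX)/andP[] := valP X.
Qed.

Lemma steiner_dist_le X S W :
  connected_set X W -> S \subset W -> steiner_dist X S < #|W|.
Proof.
case/and3P=> W0 sW cW SW.
have vW : vset (induced X W) = W by rewrite vset_induced (setIidPr sW).
have [|Y [sY tY vY cY]] := spanning_tree cW; first by rewrite vW.
have YP : subtree_on X S Y.
  by rewrite /subtree_on tY vY vW SW (subgraph_trans sY) // subgraph_induced.
by have [_ /(_ Y YP)] := steiner_distP YP; rewrite -vW -vY cY.
Qed.

(** The set [W0] guarantees that some subtree contains [S], so the minimum is attained by a subtree
    and is not a mere default value; the vertex set of that subtree is the required [W]. *)
Lemma steiner_dist_attained X S W0 : connected_set X W0 -> S \subset W0 ->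
  exists W, [/\ connected_set X W, S \subset W & #|W| = (steiner_dist X S).+1].
Proof.
case/and3P=> W00 sW cW SW.
have vW : vset (induced X W0) = W0 by rewrite vset_induced (setIidPr sW).
have [|Y0 [sY0 tY0 vY0 _]] := spanning_tree cW; first by rewrite vW.
have Y0P : subtree_on X S Y0.
  by rewrite /subtree_on tY0 vY0 vW SW (subgraph_trans sY0) // subgraph_induced.
have [[Y /and3P[/andP[sV sE] /and3P[Y_0 cY _] SY] dY] _] := steiner_distP Y0P.
have connY : connected_set X (vset Y).
  apply/connected_setP; split=> // x y xY yY.
  have /forall_inP/(_ x xY)/forall_inP/(_ y yY) := cY.
  apply: connect_sub => a b ab; rewrite connect1 // adj_induced.
  by have [_ -> ->] := edgeP ab; rewrite /adj /= (subsetP sE).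
exists (vset Y); split=> //; apply/eqP; rewrite eqn_leq (steiner_dist_le connY) //.
(* A spanning tree of the optimal tree [Y] itself has [#|vset Y| - 1] edges, all in [Y]; this bounds
   the vertices of [Y] by its edges. *)
have [Z [/andP[_ sZ] _ vZ cZ]] := spanning_tree cY Y_0.
by rewrite dY -vZ cZ ltnS subset_leq_card.
Qed.

(** * The twin relation and its classes *)

Lemma twinP X x y : reflect
  (forall z, z != x -> z != y -> adj X x z = adj X y z) (twin X x y).
Proof.
apply: (iffP eqP) => [/setP E z zx zy|E].
  by have := E z; rewrite !inE zx zy.
apply/setP=> z; rewrite !inE.
have [->|zy] := eqVneq z y.
  by have := adj_irr X y; rewrite /adj /= => ->; rewrite andbF.
have [->|zx] := eqVneq z x; first by have := adj_irr X x; rewrite /adj /= => ->.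
exact: E.
Qed.

Lemma twin_equivalence X : equivalence_rel (twin X).
Proof.
have tsym : symmetric (twin X) by move=> x y; rewrite /twin /= eq_sym.
have ttrans : transitive (twin X).
  move=> v u w uv vw; have [->|uw] := eqVneq u w; first exact: eqxx.
  move/twinP: uv => uv; move/twinP: vw => vw; apply/twinP=> x xu xw.
  (* Neither hypothesis speaks of the middle vertex [v] as a test vertex. Its adjacencies to [u] and
     to [w] are both compared with the adjacency of [u] and [w]. *)
  have [Ex|xv] := eqVneq x v; last by rewrite uv // vw.
  subst x; rewrite adj_sym vw // 1?eq_sym // adj_sym uv 1?[w == v]eq_sym //.
    exact: adj_sym.
  by rewrite eq_sym.
move=> x y z; split=> [|xy]; first exact: eqxx.
by apply/idP/idP; apply: ttrans; rewrite // tsym.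
Qed.

Lemma twin_classes_partition X : partition (twin_classes X) (vset X).
Proof.
by apply/equivalence_partitionP => x y z _ _ _; apply: twin_equivalence.
Qed.

Lemma mem_twin_class X (A : {set T}) x y :
  A \in twin_classes X -> x \in A -> y \in A -> twin X x y.
Proof.
case/imsetP=> z zX ->; rewrite !inE => /andP[_ zx] /andP[_ zy].
by have [_ <- //] := twin_equivalence X z x y.
Qed.

End Graphs.

(** * Projection to representatives; sets meeting several classes *)

Section TwinPartition.
Set Implicit Arguments.
Unset Strict Implicit.
Variables (T : finType) (X : graph T) (k : nat).
Variables (C : 'I_k -> {set T}) (c : 'I_k -> T).
Hypothesis X_connected : connected X.
Hypothesis mem_vset : forall x, (x \in vset X) = [exists i, x \in C i].
Hypothesis C_disjoint : forall i j x, x \in C i -> x \in C j -> i = j.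
Hypothesis C_twin : forall i x y, x \in C i -> y \in C i -> twin X x y.
Hypothesis c_rep : forall i, c i \in C i.
Implicit Types (S W : {set T}) (x y : T) (i j : 'I_k).

Let IS S := [set i | S :&: C i != set0].
Let reps := [set c i | i : 'I_k].
Let H := induced X reps.

Let rep x := if [pick i | x \in C i] is Some i then c i else x.

Lemma mem_IS S i x : x \in S -> x \in C i -> i \in IS S.
Proof. by move=> xS xC; rewrite inE; apply/set0Pn; exists x; apply/setIP. Qed.

Lemma class_sub_vset i : C i \subset vset X.
Proof. by apply/subsetP=> x xC; rewrite mem_vset; apply/existsP; exists i. Qed.

Lemma vset_class x : x \in vset X -> exists i, x \in C i.
Proof. by rewrite mem_vset => /existsP. Qed.

Lemma rep_class i x : x \in C i -> rep x = c i.
Proof.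
rewrite /rep => xC; case: pickP => [j xj|/(_ i)]; last by rewrite xC.
by rewrite (C_disjoint xC xj).
Qed.

Lemma rep_c i : rep (c i) = c i.
Proof. exact: rep_class. Qed.

Lemma c_injective : injective c.
Proof. by move=> i j cij; apply: (C_disjoint (c_rep i)); rewrite cij. Qed.

Lemma reps_sub_vset : reps \subset vset X.
Proof. by apply/subsetP=> _ /imsetP[i _ ->]; apply: (subsetP (class_sub_vset i)). Qed.

Lemma rep_image S : S \subset vset X -> rep @: S = [set c i | i in IS S].
Proof.
move=> sS; apply/setP=> z; apply/imsetP/imsetP=> [[x xS ->]|[i + ->]].
  have [i xC] := vset_class (subsetP sS x xS).
  by exists i; [apply: mem_IS xC | apply: rep_class].
by rewrite inE => /set0Pn[x /setIP[xS xC]]; exists x; rewrite ?(rep_class xC).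
Qed.

Lemma card_rep_image S : S \subset vset X -> #|rep @: S| = #|IS S|.
Proof. by move=> sS; rewrite rep_image // card_imset //; apply: c_injective. Qed.

(** One element of each class met is counted by [#|IS S|] and the others by the correction term; the
    truncated subtraction is exact since each class in [IS S] meets [S]. *)
Lemma card_by_class S : S \subset vset X ->
  #|S| = \sum_(i in IS S) (#|S :&: C i| - 1) + #|IS S|.
Proof.
move=> sS; rewrite -[#|IS S|]sum1_card -big_split /= -sum1_card.
rewrite (eq_bigr (fun x => \sum_(i < k | x \in C i) 1)); last first.
  move=> x xS; have [i xC] := vset_class (subsetP sS x xS).
  rewrite (big_pred1 i) // => j /=.
  by apply/idP/eqP=> [/C_disjoint/(_ xC)|->].
rewrite (exchange_big_dep (mem (IS S))) /=; last by move=> x i; apply: mem_IS.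
apply: eq_bigr => i; rewrite inE -card_gt0 => Si; rewrite subnK // -sum1_card.
by apply: eq_bigl => x; rewrite !inE.
Qed.

(** Replace [x] by its twin, then [y] by its twin. Twins agree only on vertices other than
    themselves, and [i != j] ensures that the other endpoint is such a vertex. *)
Lemma adj_between_classes i j x x' y y' : i != j ->
  x \in C i -> x' \in C i -> y \in C j -> y' \in C j -> adj X x y = adj X x' y'.
Proof.
move=> ij xC x'C yC y'C.
have ne a b : a \in C i -> b \in C j -> b != a.
  by move=> aC bC; apply: contraNneq ij => ba; rewrite ba in bC; rewrite (C_disjoint aC bC).
have /twinP -> := C_twin xC x'C; rewrite ?ne // ![adj X x' _]adj_sym.
by have /twinP -> // := C_twin yC y'C; rewrite eq_sym ne.
Qed.

Lemma adj_rep x y : x \in vset X -> y \in vset X -> rep x != rep y ->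
  adj X (rep x) (rep y) = adj X x y.
Proof.
move=> /vset_class[i xC] /vset_class[j yC]; rewrite !(rep_class xC, rep_class yC).
move=> cij; apply: (@adj_between_classes i j) => //.
by apply: contra_neq cij => ->.
Qed.

Lemma adj_neq x y : adj X x y -> x != y.
Proof. by case/edgeP. Qed.

(** Along a projected path, an edge either collapses, inside a class, or remains an edge, between
    two classes. *)
Lemma connected_set_rep_image W :
  connected_set X W -> connected_set X (rep @: W).
Proof.
case/connected_setP=> /set0Pn[w wW] sW cW; apply/connected_setP; split.
- by apply/set0Pn; exists (rep w); apply: imset_f.
- rewrite rep_image //; apply: subset_trans reps_sub_vset.
  by apply/subsetP=> _ /imsetP[i _ ->]; apply: imset_f.
move=> _ _ /imsetP[x xW ->] /imsetP[y yW ->].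
have /connectP[p] := cW x y xW yW; elim: p x xW => /= [|z p IHp] x xW.
  by move=> _ ->; apply: connect0.
case/andP; rewrite adj_induced => /and3P[xz _ zW] pz yE.
apply: connect_trans (IHp z zW pz yE).
have [->|ne] := eqVneq (rep x) (rep z); first exact: connect0.
by rewrite connect1 // adj_induced adj_rep ?(subsetP sW) // xz !imset_f.
Qed.

(** Paths of representatives lift to [W], except that two elements of one class need not be
    adjacent. With a second representative present, every class met has a neighbouring class met,
    whose elements are common neighbours of such a pair. *)
Lemma connected_set_of_rep_image W : W \subset vset X -> 1 < #|rep @: W| ->
  connected_set X (rep @: W) -> connected_set X W.
Proof.
move=> sW W1 /connected_setP[W0 sR cR]; apply/connected_setP; split=> //.
  by apply: contraNneq W0 => ->; rewrite imset0.
have step x y : x \in W -> y \in W -> adj X (rep x) (rep y) ->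
    adj (induced X W) x y.
  move=> xW yW xy; rewrite adj_induced xW yW -adj_rep ?xy ?(subsetP sW) //.
  exact: adj_neq.
move=> x y xW yW.
have nbr : exists2 u, u \in W & adj X (rep x) (rep u).
  have [_ /imsetP[z zW ->] zx] : exists2 b, b \in rep @: W & b != rep x.
    apply/exists_inP; apply: contraLR W1 => /exists_inPn E.
    rewrite -leqNgt -(cards1 (rep x)) subset_leq_card //.
    by apply/subsetP=> b /E; rewrite negbK inE.
  have /connectP[[|b p] /=] := cR _ _ (imset_f rep xW) (imset_f rep zW).
    by move=> _ E; rewrite E eqxx in zx.
  rewrite adj_induced => /andP[/and3P[xb _ /imsetP[u uW bE]] _] _.
  by exists u; rewrite -?bE.
have [xy|xy] := eqVneq (rep x) (rep y).
  have [u uW xu] := nbr.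
  apply: (@connect_trans _ _ u); rewrite connect1 // step //.
  by rewrite adj_sym -xy.
have /connectP[p] := cR _ _ (imset_f rep xW) (imset_f rep yW).
(* The path is lifted vertex by vertex; as soon as it enters the class of [y], the lift goes to [y]
   itself. Until then the current class differs from that of [y], so the path is never empty. *)
elim: p x xW xy {nbr} => /= [|b p IHp] x xW xy; first by move=> _ E; rewrite E eqxx in xy.
rewrite {1}adj_induced => /andP[/and3P[xb _ /imsetP[u uW bE]]]; subst b => pu yE.
have [uy|uy] := eqVneq (rep u) (rep y); first by rewrite connect1 ?step // -uy.
exact: connect_trans (connect1 (step x u xW uW xb)) (IHp u uW uy pu yE).
Qed.

(* A connected set containing [S] projects onto a connected set of
   representatives, losing at least the repeated elements of the classes met by
   [S]; conversely, in a connected set of representatives those of the classes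
   met by [S] may be replaced by the elements of [S]. *)
Lemma steiner_dist_reps S : S \subset vset X -> 1 < #|IS S| ->
  steiner_dist X S =
  steiner_dist H [set c i | i in IS S] + \sum_(i in IS S) (#|S :&: C i| - 1).
Proof.
move=> sS S1; rewrite -rep_image //; apply/eqP.
(* Adding the number of classes met to both sides turns the correction term into [#|S|]. *)
rewrite -(eqn_add2r #|IS S|) -addnA -card_by_class //.
have S0 : S != set0.
  apply: contraTneq S1 => ->; rewrite -card_rep_image ?sub0set //.
  by rewrite imset0 cards0.
have X0 : vset X != set0.
  by apply: contraNneq S0 => X0; rewrite -subset0 -X0.
have sreps W : W \subset vset X -> rep @: W \subset reps.
  move=> sW; rewrite rep_image //; apply/subsetP=> _ /imsetP[i _ ->].
  exact: imset_f.
have HE := connected_set_induced X reps.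
rewrite eqn_leq; apply/andP; split.
  have cV := connected_set_rep_image (connected_set_vset X_connected X0).
  have [||W [+ SW cW]] := @steiner_dist_attained _ H (rep @: S) (rep @: vset X).
  - by rewrite HE sreps.
  - exact: imsetS.
  rewrite HE => /andP[/subsetP sW conW].
  have repW x : x \in W -> rep x = x by move/sW=> /imsetP[i _ ->]; apply: rep_c.
  pose W' := S :|: (W :\: rep @: S).
  have sW' : W' \subset vset X.
    rewrite subUset sS (subset_trans (subsetDl _ _)) //.
    by case/and3P: conW.
  have repW' : rep @: W' = W.
    apply/setP=> z; apply/imsetP/idP=> [[x /setUP[xS|/setDP[xW _]] ->]|zW].
    - by rewrite (subsetP SW) ?imset_f.
    - by rewrite repW.
    case: (boolP (z \in rep @: S)) => [/imsetP[x xS ->]|zS].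
      by exists x; rewrite // inE xS.
    by exists z; rewrite ?repW // !inE zS zW orbT.
  (* Lifting needs at least two representatives; [W] has them because [S] meets several classes. *)
  have W'con : connected_set X W'.
    apply: connected_set_of_rep_image; rewrite // repW' //.
    by apply: leq_trans (subset_leq_card SW); rewrite card_rep_image.
  have := leq_trans (steiner_dist_le W'con (subsetUl _ _)) (leq_card_setU _ _).
  rewrite cardsDS // cW card_rep_image // => ltd.
  have := subset_leq_card SW; rewrite cW card_rep_image // => leI.
  rewrite -ltnS -addSn -addnS; apply: leq_trans (leq_add ltd (leqnn _)) _.
  by rewrite -addnA subnK // addnS addnC addnS.
have [W [Wcon SW cW]] := steiner_dist_attained (connected_set_vset X_connected X0) sS.
have RWcon : connected_set H (rep @: W).
  by rewrite HE connected_set_rep_image // andbT sreps //; case/and3P: Wcon.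
have := steiner_dist_le RWcon (imsetS rep SW).
have -> : W = (W :\: S) :|: S by rewrite -{2}(setIidPr SW) setUC setID.
rewrite imsetU => ltd.
have := leq_trans ltd (leq_card_setU _ _); rewrite (card_rep_image sS).
move/leq_trans/(_ (leq_add (leq_imset_card rep _) (leqnn _))).
rewrite cardsDS // cW => le.
have := leq_add le (leqnn #|S|).
by rewrite addnAC subnK -?cW ?subset_leq_card // cW addSn ltnS.
Qed.

(** * Sets inside one class *)

Lemma twin_class_homogeneous i :
  complete (induced X (C i)) || edgeless (induced X (C i)).
Proof.
have [_|/set0Pn[e]] := boolP (edgeless (induced X (C i))); first by rewrite orbT.
rewrite inE => /andP[eX eC]; apply/orP; left.
have /forall_inP/(_ e eX)/andP[/cards2P[u [v [uv eE]]] _] := valP X.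
subst e; move: eC; rewrite subUset !sub1set => /andP[uC vC].
(* One edge [uv] spreads over the class: [x] inherits from its twin [v] the edge to [u], and then
   [y] inherits from its twin [u] the edge to [x]. *)
have ux x : x \in C i -> x != u -> adj X u x.
  move=> xC xu; have [->//|xv] := eqVneq x v.
  rewrite adj_sym; have /twinP <- := C_twin vC xC; rewrite // 1?eq_sym //.
  by rewrite adj_sym.
apply/forall_inP=> x /setIP[_ xC].
apply/forall_inP=> y /setIP[_ yC].
apply/implyP=> xy; rewrite adj_induced xC yC !andbT.
have [yu|yu] := eqVneq y u; first by rewrite yu adj_sym ux // -yu.
have [->|xu] := eqVneq x u; first exact: ux.
by rewrite adj_sym; have /twinP <- := C_twin uC yC; rewrite ?ux // eq_sym.
Qed.

(** Here [S] is itself connected, and no set containing it is smaller. *)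
Lemma steiner_dist_complete_class S i : S \subset C i -> S != set0 ->
  complete (induced X (C i)) -> steiner_dist X S = #|S| - 1.
Proof.
move=> SC S0 /forall_inP cC.
have sS := subset_trans SC (class_sub_vset i).
have conS : connected_set X S.
  apply/connected_setP; split=> // x y xS yS.
  have [->|xy] := eqVneq x y; first exact: connect0.
  rewrite connect1 // adj_induced xS yS.
  have inC z : z \in S -> z \in vset (induced X (C i)).
    by move=> zS; rewrite vset_induced inE (subsetP sS) ?(subsetP SC).
  have /forall_inP/(_ y (inC y yS))/implyP/(_ xy) := cC x (inC x xS).
  by rewrite adj_induced => /andP[->].
have [W [_ SW cW]] := steiner_dist_attained conS (subxx S).
apply/eqP; rewrite eqn_leq -ltnS subn1 prednK ?card_gt0 //.
rewrite (steiner_dist_le conS) //=.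
by rewrite -ltnS prednK ?card_gt0 // -cW subset_leq_card.
Qed.

(** A neighbour of one element of [S] lies outside the class, so it is a neighbour of all its twins
    in [S], and adding it connects [S]. No fewer vertices suffice, since [S] alone spans no edge. *)
Lemma steiner_dist_edgeless_class S i : S \subset C i -> 1 < #|S| ->
  edgeless (induced X (C i)) -> steiner_dist X S = #|S|.
Proof.
move=> SC S1 /eqP C0.
have noC x y : x \in C i -> y \in C i -> adj X x y = false.
  move=> xC yC; apply/negP=> xy.
  have : adj (induced X (C i)) x y by rewrite adj_induced xy xC.
  by rewrite /adj /= C0 inE.
have sS := subset_trans SC (class_sub_vset i).
have [x [y [xS yS xy]]] := card_gt1P S1.
have S0 : S != set0 by apply/set0Pn; exists x.
have X0 : vset X != set0 by apply/set0Pn; exists x; apply: (subsetP sS).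
have xC := subsetP SC x xS.
(* As [X] is connected and contains [y] besides [x], some edge leaves the singleton of [x]. *)
have [z xz] : exists z, adj X x z.
  have := connected_crossing (W := [set x]) X_connected (subsetP sS x xS) (subsetP sS y yS).
  case; rewrite ?set11 // ?inE 1?eq_sym //.
  by move=> u [v [/set1P-> _ xv]]; exists v.
have zC : z \notin C i by apply/negP=> zC; rewrite noC in xz.
have zS : z \notin S by apply: contra zC; apply: (subsetP SC).
have zX : z \in vset X by case/edgeP: xz.
have zadj u : u \in S -> adj X u z.
  move=> uS; have uC := subsetP SC u uS.
  have /twinP <- // := C_twin xC uC; apply: contraNneq zC => -> //.
have con : connected_set X (z |: S).
  apply/connected_setP; split.
  - by apply/set0Pn; exists z; apply: setU11.
  - by rewrite subUset sub1set zX.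
  have toz u : u \in z |: S -> connect (adj (induced X (z |: S))) u z.
    case/setU1P=> [->|uS]; first exact: connect0.
    by rewrite connect1 // adj_induced zadj // !inE uS eqxx orbT.
  move=> u v uS vS; rewrite (connect_trans (toz u uS)) //.
  by rewrite connect_adj_sym toz.
have := steiner_dist_le con (subsetUr _ _); rewrite cardsU1 zS ltnS => le.
have [W [Wcon SW cW]] := steiner_dist_attained (connected_set_vset X_connected X0) sS.
apply/eqP; rewrite eqn_leq le -ltnS -cW /= ltn_neqAle subset_leq_card // andbT.
apply/negP=> /eqP cSW.
have WE : W = S by apply/esym/eqP; rewrite eqEcard SW cSW leqnn.
rewrite WE in Wcon; have /connected_setP[_ _ cS] := Wcon.
have /connectP[[|b p] /=] := cS x y xS yS.
  by move=> _ yx; rewrite yx eqxx in xy.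
rewrite adj_induced => /andP[/and3P[xb _ bS] _] _.
by rewrite noC // in xb; apply: (subsetP SC).
Qed.

(** * Splitting the sum by the number of classes met *)

Lemma card_IS_le1 S i : S \subset C i -> #|IS S| <= 1.
Proof.
move=> SC; rewrite -(cards1 i) subset_leq_card //; apply/subsetP=> j.
rewrite !inE => /set0Pn[x /setIP[xS xC]].
by rewrite (C_disjoint xC (subsetP SC x xS)).
Qed.

Lemma sub_class_of_card_IS S : S \subset vset X -> S != set0 ->
  #|IS S| <= 1 -> exists i, S \subset C i.
Proof.
move=> sS /set0Pn[x xS] S1; have [i xC] := vset_class (subsetP sS x xS).
exists i; apply/subsetP=> y yS; have [j yC] := vset_class (subsetP sS y yS).
by rewrite (card_le1_eqP S1 j i) ?(mem_IS xS xC) ?(mem_IS yS yC).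
Qed.

Theorem steiner_wiener_twin_partition m : 2 <= m ->
  steiner_wiener m X =
    \sum_(i < k | complete (induced X (C i))) (m - 1) * 'C(#|C i|, m)
    + \sum_(i < k | edgeless (induced X (C i))) m * 'C(#|C i|, m)
    + \sum_(S : {set T} | [&& S \subset vset X, #|S| == m & 1 < #|IS S|])
        (steiner_dist H [set c i | i in IS S]
         + \sum_(i in IS S) (#|S :&: C i| - 1)).
Proof.
move=> m2; rewrite /steiner_wiener (bigID (fun S => 1 < #|IS S|)) /= addnC.
congr (_ + _); last first.
  apply: eq_big => [S|S /andP[/andP[sS _] S1]]; first by rewrite andbA.
  exact: steiner_dist_reps.
have card_neq0 S : #|S| == m -> S != set0.
  by move=> /eqP Sm; rewrite -card_gt0 Sm ltnW.
(* A nonempty set meeting at most one class lies in exactly one, so the inner sum has a single term;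
   exchanging the sums then groups these sets by class. *)
rewrite (eq_bigr (fun S => \sum_(i < k | S \subset C i) steiner_dist X S)); last first.
  move=> S /andP[/andP[sS Sm]]; rewrite -leqNgt => S1.
  have [i SC] := sub_class_of_card_IS sS (card_neq0 S Sm) S1.
  have /set0Pn[x xS] := card_neq0 S Sm.
  rewrite (big_pred1 i) // => j /=; apply/idP/eqP => [SCj|->//].
  exact: C_disjoint (subsetP SCj x xS) (subsetP SC x xS).
rewrite (exchange_big_dep xpredT) //= [X in _ = X + _]big_mkcond.
rewrite [X in _ = _ + X]big_mkcond -big_split /=; apply: eq_bigr => i _.
rewrite (eq_bigl (fun S : {set T} => (S \subset C i) && (#|S| == m))); last first.
  move=> S; apply/idP/idP=> [/andP[/andP[/andP[_ ->] _] ->] //|/andP[SC ->]].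
  by rewrite SC (subset_trans SC (class_sub_vset i)) -leqNgt (card_IS_le1 SC).
have sumE d : (forall S, S \subset C i -> #|S| = m -> steiner_dist X S = d) ->
    \sum_(S : {set T} | (S \subset C i) && (#|S| == m)) steiner_dist X S
      = d * 'C(#|C i|, m).
  move=> dE; rewrite (eq_bigr (fun=> d)) => [|S /andP[SC /eqP]]; last exact: dE.
  rewrite sum_nat_const mulnC -cards_draws; congr (_ * _).
  by apply: eq_card => S; rewrite inE.
have [cC|ncC] := boolP (complete _).
  rewrite (sumE (m - 1)) => [|S SC Sm]; last first.
    rewrite -Sm (steiner_dist_complete_class SC) //.
    by rewrite -card_gt0 Sm ltnW.
  (* A class that is both complete and edgeless occurs in both sums, but it has at most one element,
     so its binomial coefficient vanishes as [m] is at least 2. *)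
  case: ifP => [eC|_]; last by rewrite addn0.
  suff -> : 'C(#|C i|, m) = 0 by rewrite !muln0.
  apply: bin_small; apply: leq_trans m2; rewrite ltnS leqNgt.
  apply/negP=> /card_gt1P[x [y [xC yC xy]]].
  have inC z : z \in C i -> z \in vset (induced X (C i)).
    by move=> zC; rewrite vset_induced inE zC (subsetP (class_sub_vset i)).
  have /forall_inP/(_ x (inC x xC))/forall_inP/(_ y (inC y yC)) := cC.
  by rewrite xy /adj /= (eqP eC) inE.
have := twin_class_homogeneous i; rewrite (negPf ncC) /= => eC.
rewrite eC add0n; apply: sumE => S SC Sm.
by rewrite -Sm; apply: steiner_dist_edgeless_class eC; rewrite // Sm.
Qed.

End TwinPartition.

(** * The zero-divisor graph *)

Lemma zdg_connected (R : finComPzRingType) (I : {set R}) :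
  is_ideal I -> connected (zdg I).
Proof.
case=> _ absorb.
have absorbr (a x : R) : x \in I -> (x * a)%R \in I by rewrite GRing.mulrC; apply: absorb.
(* Consecutive elements of the walks below may coincide, hence [connect] in place of [adj]. *)
have adj_connect (x y : R) : x \notin I -> y \notin I -> (x * y)%R \in I ->
    connect (adj (zdg I)) x y.
  move=> xI yI xyI; have [->|xy] := eqVneq x y; first exact: connect0.
  apply: connect1; apply/imset2P; exists x y => //.
    by rewrite inE xI; apply/existsP; exists y; rewrite yI.
  by rewrite !inE yI xy xyI !andbT; apply/existsP; exists x; rewrite xI GRing.mulrC.
apply/forall_inP=> x; rewrite inE => /andP[xI /existsP[a /andP[aI xa]]].
apply/forall_inP=> y; rewrite inE => /andP[yI /existsP[b /andP[bI yb]]].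
(* If [a * b] is in [I], the walk is [x], [a], [b], [y]; otherwise it is [x], [a * b], [y]. *)
have [abI|abI] := boolP ((a * b)%R \in I).
  apply: connect_trans (adj_connect x a xI aI xa) _.
  apply: connect_trans (adj_connect a b aI bI abI) _.
  by apply: adj_connect; rewrite // GRing.mulrC.
apply: (@connect_trans _ _ (a * b)%R); apply: adj_connect => //.
  by rewrite GRing.mulrA absorbr.
by rewrite -GRing.mulrA absorb // GRing.mulrC.
Qed.

Theorem theorem5p4 (R : finComPzRingType) (I : {set R}) (hI : is_ideal I)
    (k : nat) (C : 'I_k -> {set R}) (c : 'I_k -> R)
    (C_inj : injective C)
    (C_classes : [set C i | i : 'I_k] = twin_classes (zdg I))
    (c_rep : forall i : 'I_k, c i \in C i)
    (m : nat) (hm : 2 <= m) :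
  let G := zdg I in
  let H := induced G [set c i | i : 'I_k] in
  let IS := fun S : {set R} => [set i : 'I_k | S :&: C i != set0] in
  steiner_wiener m G =
    \sum_(i < k | complete (induced G (C i))) (m - 1) * 'C(#|C i|, m)
    + \sum_(i < k | edgeless (induced G (C i))) m * 'C(#|C i|, m)
    + \sum_(S : {set R} | [&& S \subset vset G, #|S| == m & 1 < #|IS S|])
        (steiner_dist H [set c i | i in IS S]
         + \sum_(i in IS S) (#|S :&: C i| - 1)).
Proof.
have Ctw i : C i \in twin_classes (zdg I) by rewrite -C_classes imset_f.
have /and3P[/eqP cover_C trivC _] := twin_classes_partition (zdg I).
apply: steiner_wiener_twin_partition => //; first exact: zdg_connected.
- move=> x; rewrite -cover_C -C_classes; apply/bigcupP/existsP.
    by case=> _ /imsetP[i _ ->] xC; exists i.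
  by case=> i xC; exists (C i); rewrite ?imset_f.
(* Both sets are the block of [x] in the partition, and [C_inj] passes from equal blocks to equal
   indices. *)
- move=> i j x xi xj; apply: C_inj.
  by rewrite -(def_pblock trivC (Ctw i) xi) (def_pblock trivC (Ctw j) xj).
- by move=> i x y; apply: mem_twin_class.
Qed.
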